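(* Let $X$ be a nonempty set, let $f:X\to\mathbb{R}$, and let $\{x^k\}$ be a sequence in $X$ generated by an auxiliary-function algorithm for minimizing $f$. Suppose the algorithm is in the SUMMA2 class, so that there are functions $h_k:X\to[0,\infty)$ such that, for all $x\in X$ and all $k$, $$h_k(x)+f(x)\ge h_{k+1}(x)+f(x^k).$$ Then the decreasing sequence $\{f(x^k)\}$ converges to $\beta:=\inf_{x\in X}f(x)\in[-\infty,\infty)$.
   Context: An iterative procedure for minimizing $f$ over $X$ is an auxiliary-function (AF) algorithm if at each step $k$ the iterate $x^k$ is a minimizer over $x\in X$ of $G_k(x)=f(x)+g_k(x)$, where $g_k(x)\ge 0$ for all $x\in X$ and $g_k(x^{k-1})=0$. For such an algorithm $\{f(x^k)\}$ is decreasing. An algorithm is in the SUMMA2 class if for each sequence $\{x^k\}$ it generates there are functions $h_k:X\to[0,\infty)$ satisfying the displayed inequality for all $x\in X$ and all $k$; the $h_k$ need not equal the $g_k$, and $h_k(x^{k-1})=0$ is not required. *)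

(* Defs.v *)
From HB Require Import structures.
From mathcomp Require Import all_boot all_order all_algebra.
From mathcomp Require Import all_classical all_reals all_analysis.
Set Implicit Arguments.
Unset Strict Implicit.
Unset Printing Implicit Defensive.
Import Order.TTheory GRing.Theory Num.Theory.
Import numFieldNormedType.Exports.
Local Open Scope classical_set_scope.
Local Open Scope ring_scope.

(* An iterative procedure is represented by the set of all the sequences
   x^0, x^1, x^2, ... that it generates. *)
Definition algorithm (X : Type) := set (nat -> X).

Definition is_minimizer (R : realType) (X : Type) (F : X -> R) (x : X) : Prop :=
  forall y : X, F x <= F y.

(* x 0 is the starting point and the steps are numbered from 1, so step k is
   indexed by k.+1 with k : nat, and g 0 plays no role. *)
Definition AF_sequence (R : realType) (X : Type) (f : X -> R)
    (g : nat -> X -> R) (x : nat -> X) : Prop :=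
  forall k : nat,
    [/\ forall y : X, 0 <= g k.+1 y,
        g k.+1 (x k) = 0
      & is_minimizer (fun y : X => f y + g k.+1 y) (x k.+1)].

(* The auxiliary functions may depend on the generated sequence, since g_k is
   required to vanish at x^(k-1). *)
Definition AF_algorithm (R : realType) (X : Type) (f : X -> R)
    (A : algorithm X) : Prop :=
  forall x : nat -> X, A x -> exists g : nat -> X -> R, AF_sequence f g x.

(* As for g, the inequality is only required at the steps 1, 2, ... *)
Definition SUMMA2_sequence (R : realType) (X : Type) (f : X -> R)
    (h : nat -> X -> R) (x : nat -> X) : Prop :=
  (forall (k : nat) (y : X), 0 <= h k.+1 y) /\
  (forall (k : nat) (y : X),
     h k.+1 y + f y >= h k.+2 y + f (x k.+1)).

Definition SUMMA2 (R : realType) (X : Type) (f : X -> R)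
    (A : algorithm X) : Prop :=
  forall x : nat -> X, A x -> exists h : nat -> X -> R, SUMMA2_sequence f h x.

(* Main.v *)
Require Import Defs.
From HB Require Import structures.
From mathcomp Require Import all_boot all_order all_algebra.
From mathcomp Require Import all_classical all_reals all_analysis.
From mathcomp Require Import lra.
Set Implicit Arguments.
Unset Strict Implicit.
Unset Printing Implicit Defensive.
Import Order.TTheory GRing.Theory Num.Theory.
Import numFieldNormedType.Exports.
Local Open Scope classical_set_scope.
Local Open Scope ring_scope.

(** If [f (x k)] stayed above [f y + e] for some [y] and [e > 0], the SUMMA2
    inequality at [y] would make [h k y] drop by at least [e] at every step,
    which is impossible for a nonnegative quantity. *)

(** Comparing the minimizer [x k.+1] with [x k], where [g k.+1] vanishes, bounds
    [f (x k.+1) + g k.+1 (x k.+1)] by [f (x k)]; the nonnegative [g] term can then be dropped. *)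
Lemma AF_sequence_nonincreasing (R : realType) (X : Type) (f : X -> R)
    (g : nat -> X -> R) (x : nat -> X) :
  AF_sequence f g x -> nonincreasing_seq (fun k => f (x k)).
Proof.
move=> gx; apply/nonincreasing_seqP => k.
have [g_ge0 gxk xk_min] := gx k.
have := xk_min (x k); have := g_ge0 (x k.+1); rewrite /= gxk; lra.
Qed.

Lemma SUMMA2_sequence_lt (R : realType) (X : Type) (f : X -> R)
    (h : nat -> X -> R) (x : nat -> X) (y : X) (e : R) :
  SUMMA2_sequence f h x -> 0 < e -> exists k, f (x k) < f y + e.
Proof.
move=> [h_ge0 hS] e0; apply: contrapT => /forallNP xy.
(* The drops accumulate from [h 1], the first index at which [h] is constrained. *)
have h_le k : h k.+1 y <= h 1%N y - e *+ k.
  elim: k => [|k IHk]; first by rewrite mulr0n subr0.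
  have /negP := xy k.+1; rewrite -leNgt mulrSr => ?.
  have := hS k y; lra.
have [n hn] : exists n, h 1%N y < e *+ n.
  exists (Num.bound (h 1%N y / e)).
  rewrite -mulr_natl -ltr_pdivrMr//.
  by apply: archi_boundP; rewrite divr_ge0// ltW.
have := h_le n; have := h_ge0 n y; lra.
Qed.

Theorem mainTheorem2 (R : realType) (X : Type) (hX : [set: X] !=set0)
    (f : X -> R) (A : algorithm X) (hAF : AF_algorithm f A)
    (hS : SUMMA2 f A) (x : nat -> X) (hx : A x) :
  let beta : \bar R := ereal_inf [set (f y)%:E | y in [set: X]] in
  [/\ nonincreasing_seq (fun k : nat => f (x k)),
      (beta < +oo)%E
    & (f (x k))%:E @[k --> \oo] --> beta].
Proof.
move=> beta; have [g /AF_sequence_nonincreasing fx] := hAF x hx.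
have [h hSx] := hS x hx.
have beta_le y : (beta <= (f y)%:E)%E by apply: ereal_inf_lbound; exists y.
split => //; first exact: le_lt_trans (beta_le (x 0%N)) (ltry _).
(* A nonincreasing sequence of extended reals converges to the infimum of its range, possibly [-oo],
   so it remains to identify that infimum with [beta]. *)
have -> : beta = ereal_inf (range (fun k => (f (x k))%:E)).
  apply/eqP; rewrite eq_le; apply/andP; split.
    by apply: le_ereal_inf_tmp => _ [k _ <-].
  apply: le_ereal_inf_tmp => _ [y _ <-].
  (* Allowing a slack [e] suffices: some iterate has value below [f y + e]. *)
  apply/lee_addgt0Pr => e e0.
  have [k fxk] := SUMMA2_sequence_lt y hSx e0.
  apply: (@le_trans _ _ (f (x k))%:E); last by rewrite -EFinD lee_fin ltW.
  by apply: ereal_inf_lbound; exists k.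
by apply: ereal_nonincreasing_cvgn => m n /fx; rewrite lee_fin.
Qed.
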